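(* Let $\{H_n\}_{n\ge 1}$ be a positive linear recurrence sequence with size $S$ and length $L$, where $(L,c_1)\neq(1,1)$. For each $n$ let $K_n$ be the number of summands of the legal decomposition of an integer chosen uniformly at random from $[H_n,H_{n+1})$. Then there is a constant $c>0$ such that $\operatorname{Var}[K_n]\ge cn$ for all $n>L$.
   Context: **Positive linear recurrence sequence (PLRS).** A sequence $\{H_n\}_{n=1}^\infty$ of positive integers is a PLRS if (1) there are non-negative integers $L,c_1,\dots,c_L$ with $L,c_1,c_L$ positive such that $H_{n+1}=c_1H_n+\cdots+c_LH_{n+1-L}$ for all $n\ge L$; and (2) $H_1=1$ and for $1\le n<L$ we have $H_{n+1}=c_1H_n+c_2H_{n-1}+\cdots+c_nH_1+1$. Its size is $S=c_1+\cdots+c_L$ and its length is $L$. The degenerate case $L=c_1=1$ (the constant sequence $1$) is excluded. **Legal decompositions.** Call a finite sequence $(a_1,\dots,a_m)$ of non-negative integers admissible if it is empty ($m=0$) or if one of the following holds. Condition 1: $1\le m<L$ and $a_i=c_i$ for $1\le i\le m$. Condition 2: there is $s\in\{1,\dots,L\}$ with $s\le m$ such that $a_1=c_1,\dots,a_{s-1}=c_{s-1}$, $a_s<c_s$, and the sequence $(b_i)_{i=1}^{m-s}$ with $b_i=a_{s+i}$ is admissible. A decomposition $\omega=\sum_{i=1}^m a_iH_{m+1-i}$ of a positive integer $\omega$ (equivalently, the sequence $(a_i)_{i=1}^m$) is legal if $m\ge 1$, $a_1>0$ and $(a_1,\dots,a_m)$ is admissible. Its number of summands is $a_1+\cdots+a_m$.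 By the (known) Generalized Zeckendorf Theorem, every positive integer has a unique legal decomposition; those of integers in $[H_n,H_{n+1})$ are the legal ones with $m=n$. **Probability space.** $\Omega_n$ is the set of legal decompositions of the integers in $[H_n,H_{n+1})$, so $|\Omega_n|=H_{n+1}-H_n$, and it carries the uniform probability measure. $K_n(\omega)$ is the number of summands of $\omega\in\Omega_n$; the variance is taken with respect to this measure. *)

(* Defs.v *)
From HB Require Import structures.
From mathcomp Require Import all_boot all_order all_algebra.
From mathcomp Require Import all_classical all_reals all_analysis.

Set Implicit Arguments.
Unset Strict Implicit.
Unset Printing Implicit Defensive.

Import Order.TTheory GRing.Theory Num.Theory.

Local Open Scope classical_set_scope.
Local Open Scope nat_scope.

(* Sequences are indexed from 1: [H 0], [c 0] and [c i] for [i > L] are never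
   used below. All subtractions on indices are exact on the given ranges. *)
Definition is_PLRS (L : nat) (c H : nat -> nat) : Prop :=
  (forall n, 0 < n -> 0 < H n) /\
  [/\ [/\ 0 < L, 0 < c 1 & 0 < c L],
      forall n, L <= n ->
        H n.+1 = \sum_(1 <= i < L.+1) c i * H (n.+1 - i),
      H 1 = 1
    & forall n, 1 <= n < L ->
        H n.+1 = \sum_(1 <= i < n.+1) c i * H (n.+1 - i) + 1].

(* [term a i] is [a_i] when [a] is read as [(a_1, ..., a_m)]. *)
Definition term (a : seq nat) (i : nat) : nat := nth 0 a i.-1.

Inductive admissible (L : nat) (c : nat -> nat) : seq nat -> Prop :=
| admissible_nil : admissible L c [::]
| admissible_cond1 (a : seq nat) :
    1 <= size a < L ->
    (forall i, 1 <= i <= size a -> term a i = c i) ->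
    admissible L c a
| admissible_cond2 (s : nat) (a : seq nat) :
    1 <= s <= L -> s <= size a ->
    (forall i, 1 <= i < s -> term a i = c i) ->
    term a s < c s ->
    admissible L c (drop s a) ->
    admissible L c a.

Definition legal (L : nat) (c : nat -> nat) (a : seq nat) : Prop :=
  [/\ 1 <= size a, 0 < term a 1 & admissible L c a].

Definition decomp_value (H : nat -> nat) (a : seq nat) : nat :=
  \sum_(1 <= i < (size a).+1) term a i * H ((size a).+1 - i).

(* For a nondegenerate PLRS a positive integer has, by the Generalized
   Zeckendorf Theorem, exactly one
   legal decomposition, so the choice made by [xget] is the only possible one,
   and the default [[::]] is returned only for [w = 0]. *)
Definition legal_decomp (L : nat) (c H : nat -> nat) (w : nat) : seq nat :=
  xget [::] [set a | legal L c a /\ decomp_value H a = w].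

Definition num_summands (L : nat) (c H : nat -> nat) (w : nat) : nat :=
  sumn (legal_decomp L c H w).

(* Uniform law on the integers of [[lo, hi)]: the counting measure restricted
   to that interval and normalized. The fallback law [dirac 0] of [mnormalize]
   only matters when the interval is empty. *)
Definition uniform_nat (R : realType) (lo hi : nat) : probability nat R :=
  mnormalize
    (mrestr (@counting nat R) (I : measurable [set w : nat | lo <= w < hi]))
    (dirac 0).

(* Main.v *)
(* Digit strings are read by an automaton whose state is the number of digits
   of c_1 ... c_L matched so far; listing the strings of each length in
   lexicographic order makes their values consecutive integers, which gives the
   Zeckendorf bijection.  For the variance, let q be least with
   c_1 + ... + c_q >= 2.  After each of the prefixes 0^q and 1 0^(q-1) the
   remainder is an arbitrary admissible string, so these two families have the
   same digit-sum distribution up to a shift by 1, and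
   (y - t)^2 + (y + 1 - t)^2 = 2 (y + 1/2 - t)^2 + 1/2
   yields a gain proportional to the number of strings.  The other strings
   split into shifted copies of shorter instances, so induction on the length
   makes the variance grow linearly.  For small n > L it suffices that both 1
   and 2 occur as numbers of summands. *)
Require Import Defs.
From mathcomp Require Import all_boot all_order all_algebra.
From mathcomp Require Import all_classical all_reals all_analysis.
From mathcomp Require Import zify ring lra.

Import Order.TTheory GRing.Theory Num.Theory.

(** * Admissible strings as runs of the matching automaton *)

Section Words.
Set Implicit Arguments.
Unset Strict Implicit.
Variables (L : nat) (c : nat -> nat).

Let prefix_nth j k i : i < k -> nth 0 (map c (iota j k)) i = c (j + i).
Proof. by move=> ik; rewrite (@nth_map _ 0) ?size_iota // nth_iota. Qed.

(* [words m j] lists, in increasing order of value, the strings of [m] digits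
   that can follow a partial block [c 1, ..., c j]; [words m 0] lists the
   admissible strings of length [m], leading zeros included. *)
Fixpoint words (m j : nat) : seq (seq nat) :=
  if L <= j then [::] else
  if m is m'.+1 then
    [seq a :: b | a <- iota 0 (c j.+1), b <- words m' 0] ++
    [seq c j.+1 :: b | b <- words m' j.+1]
  else [:: [::]].

Lemma words_geL m j : L <= j -> words m j = [::].
Proof. by case: m => [|m] /= ->. Qed.

Lemma words0 j : j < L -> words 0 j = [:: [::]].
Proof. by rewrite ltnNge => /negbTE /= ->. Qed.

Lemma wordsS m j : j < L ->
  words m.+1 j = [seq a :: b | a <- iota 0 (c j.+1), b <- words m 0] ++
                 [seq c j.+1 :: b | b <- words m j.+1].
Proof. by rewrite ltnNge => /negbTE /= ->. Qed.

Lemma mem_words_cons m j a b : (a :: b \in words m.+1 j) =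
  (j < L) && ((a < c j.+1) && (b \in words m 0) ||
              (a == c j.+1) && (b \in words m j.+1)).
Proof.
case: (ltnP j L) => [jL|Lj]; last by rewrite words_geL.
rewrite wordsS // mem_cat; congr orb.
- apply/allpairsP/andP => [[[x y] /= [+ yw [-> ->]]]|[ac bw]].
    by rewrite mem_iota add0n.
  by exists (a, b); rewrite /= mem_iota add0n.
- apply/mapP/andP => [[y yw [-> ->]]|[/eqP-> bw]]; first by [].
  by exists b.
Qed.

Lemma size_words m j a : a \in words m j -> size a = m.
Proof.
elim: m j a => [|m IH] j a.
  case: (ltnP j L) => [jL|Lj]; last by rewrite words_geL.
  by rewrite words0 // inE => /eqP ->.
case: a => [|a b].
  case: (ltnP j L) => [jL|Lj]; last by rewrite words_geL.
  by rewrite wordsS // mem_cat => /orP[/allpairsP[[]] ? ? []|/mapP[]].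
by rewrite mem_words_cons => /andP[_] /orP[] /andP[_] /IH /= ->.
Qed.

Lemma nil_words j : ([::] \in words 0 j) = (j < L).
Proof. by rewrite /=; case: leqP => //. Qed.

(** Restoring the [j] matched digits in front makes the induction work: a run that ends in state [j]
    is Condition 1, and a digit below [c j.+1] closes a block by Condition 2 with [s = j.+1]. *)
Lemma words_admissible m j b : b \in words m j ->
  admissible L c (map c (iota 1 j) ++ b).
Proof.
elim: m j b => [|m IH] j b.
  case: (ltnP j L) => [jL|Lj]; last by rewrite words_geL.
  rewrite words0 // inE => /eqP ->; rewrite cats0.
  case: j jL => [|j] jL; first exact: admissible_nil.
  apply: admissible_cond1; rewrite size_map size_iota; first by [].
  by move=> [//|i] /andP[_ ij]; rewrite /term prefix_nth.
case: b => [/size_words //|a b].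
rewrite mem_words_cons => /andP[jL /orP[] /andP[]].
- move=> ac /IH /= adm.
  have sz : size (map c (iota 1 j)) = j by rewrite size_map size_iota.
  apply: (@admissible_cond2 L c j.+1); rewrite ?size_cat ?sz //=.
  + by rewrite addnS ltnS leq_addr.
  + move=> [//|i] /andP[_ ij]; rewrite /term /= nth_cat sz.
    have ij' : i < j by [].
    by rewrite ij' prefix_nth.
  + by rewrite /term /= nth_cat sz ltnn subnn.
  + by rewrite drop_cat sz ltnNge leqnSn /= subSn // subnn /= drop0.
- move=> /eqP-> /IH.
  have -> : iota 1 j.+1 = iota 1 j ++ [:: j.+1].
    by rewrite -[j.+1]addn1 iotaD add1n addn1.
  by rewrite map_cat -catA.
Qed.

(** Reading [k] matching digits moves the automaton from state [j] to state [j + k]; this handles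
    the matched part of a block in both conditions of [admissible]. *)
Lemma words_prefix m j k b : 0 < L -> j + k < L -> b \in words m (j + k) ->
  map c (iota j.+1 k) ++ b \in words (k + m) j.
Proof.
move=> L0; elim: k j => [|k IH] j; first by rewrite addn0.
move=> jk bw; rewrite /= mem_words_cons eqxx /= (IH j.+1) ?addSnnS // orbT.
by rewrite andbT; lia.
Qed.

Lemma admissible_words a : 0 < L -> admissible L c a -> a \in words (size a) 0.
Proof.
move=> L0; elim=> {a} [|a /andP[s1 sL] ac|s a /andP[s1 sL] sa ac alt _ IH].
- by rewrite nil_words.
- have -> : a = map c (iota 1 (size a)) ++ [::].
    rewrite cats0; apply: (@eq_from_nth _ 0); first by rewrite size_map size_iota.
    by move=> i ia; rewrite prefix_nth // -ac.
  rewrite size_cat addn0 size_map size_iota -{2}[size a]addn0.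
  by apply: words_prefix; rewrite ?nil_words.
- case: s s1 sL sa ac alt IH => [//|s] _ sL sa ac alt IH.
  have -> : a = map c (iota 1 s) ++ term a s.+1 :: drop s.+1 a.
    rewrite -{1}(cat_take_drop s a); congr cat; last by rewrite (drop_nth 0).
    have szt : size (take s a) = s by rewrite size_takel // ltnW.
    apply: (@eq_from_nth _ 0); rewrite szt ?size_map ?size_iota // => i ia.
    by rewrite prefix_nth // nth_take // -ac.
  rewrite size_cat size_map size_iota.
  by apply: words_prefix => //=; rewrite add0n mem_words_cons alt IH sL.
Qed.

Lemma nseq0_words m : 0 < L -> 0 < c 1 -> nseq m 0 \in words m 0.
Proof.
move=> L0 c1; elim: m => [|m IH]; first by rewrite nil_words.
by rewrite mem_words_cons L0 c1 IH.
Qed.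

End Words.

(** * Counting, values and uniqueness of legal decompositions *)

Section Values.
Set Implicit Arguments.
Unset Strict Implicit.
Variables (L : nat) (c H : nat -> nat) (hH : is_PLRS L c H).

Let L0 : 0 < L. Proof. by case: hH => _ [[]]. Qed.
Let c1_gt0 : 0 < c 1. Proof. by case: hH => _ [[]]. Qed.

Local Notation words := (words L c).

Lemma size_wordsS m j : j < L ->
  size (words m.+1 j) = c j.+1 * size (words m 0) + size (words m j.+1).
Proof. by move=> jL; rewrite wordsS // size_cat size_allpairs size_iota size_map. Qed.

(** Sort the words by the position [j + i] of the first digit below [c]. The last summand counts the
    word that matches [c] to its end, possible only while fewer than [L - j] digits remain; for
    [j = 0] it becomes the [+ 1] in the initial conditions of a PLRS. *)
Lemma size_words_sum m j : j <= L ->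
  size (words m j) =
  \sum_(1 <= i < (minn (L - j) m).+1) c (j + i) * size (words (m - i) 0)
  + (m < L - j).
Proof.
elim: m j => [|m IH] j; rewrite leq_eqVlt => /predU1P[->|jL].
- by rewrite words_geL // subnn minnn ltnn big_geq.
- by rewrite words0 // minn0 big_geq // subn_gt0 jL.
- by rewrite words_geL // subnn min0n ltn0 big_geq.
rewrite size_wordsS // (IH j.+1) // subnS.
have [k ->] : exists k, L - j = k.+1 by exists (L - j).-1; lia.
rewrite minnSS [in RHS]big_ltn // addn1 subSS subn0 addnA ltnS.
congr (_ + _ + _); rewrite [RHS] (big_addn 1 _ 1) subSS subn0 /=.
by apply: eq_big_nat => i _; rewrite addn1 addSnnS subSS.
Qed.

Lemma size_words_H m : size (words m 0) = H m.+1.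
Proof.
case: (hH) => _ [_ Hrec H1 Hsmall].
elim/ltn_ind: m => m IH; rewrite size_words_sum // subn0.
case: (ltnP m L) => [mL|Lm].
  case: m IH mL => [|m] IH mL; first by rewrite big_geq // H1.
  rewrite Hsmall //; congr addn.
  by apply: eq_big_nat => i im; rewrite add0n IH; [congr (_ * H _); lia|lia].
rewrite Hrec // addn0.
by apply: eq_big_nat => i im; rewrite add0n IH; [congr (_ * H _); lia|lia].
Qed.

Lemma decomp_value_cons d b :
  decomp_value H (d :: b) = d * H (size b).+1 + decomp_value H b.
Proof.
rewrite /decomp_value big_ltn //= subSS subn0; congr addn.
rewrite (big_addn 1 _ 1) subSS subn0.
by apply: eq_big_nat => i /andP[i0 _]; rewrite addn1 subSS /term -(prednK i0).
Qed.

Let flatten_iota k h :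
  [seq a * h + v | a <- iota 0 k, v <- iota 0 h] = iota 0 (k * h).
Proof.
elim: k => [|k IH] //.
rewrite -[k.+1]addn1 iotaD allpairs_cat IH /= cats0 add0n.
by rewrite mulnDl mul1n iotaD -iotaDl addn0 add0n.
Qed.

(** A leading digit [a] shifts the values of the tails, which fill an initial interval of length
    [H m.+1], by [a * H m.+1]; so the families for successive digits, ending with [c j.+1], fill
    adjacent intervals. *)
Lemma words_value m j :
  map (decomp_value H) (words m j) = iota 0 (size (words m j)).
Proof.
elim: m j => [|m IH] j; case: (ltnP j L) => [jL|Lj]; rewrite ?(words_geL _ _ Lj) //.
  by rewrite words0 //= /decomp_value big_geq.
rewrite size_wordsS // wordsS // map_cat iotaD map_allpairs -map_comp add0n.
rewrite -flatten_iota -(IH 0) allpairs_mapr; congr cat.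
  apply/eq_in_allpairs => a b _ bw.
  by rewrite decomp_value_cons (size_words bw) size_words_H.
rewrite -[X in iota X]addn0 iotaDl -(IH j.+1) -map_comp.
by apply/eq_in_map => b bw /=; rewrite decomp_value_cons (size_words bw) size_words_H.
Qed.

Lemma words_value_inj m : {in words m 0 &, injective (decomp_value H)}.
Proof.
move=> a b aw bw ab.
have u : uniq (map (decomp_value H) (words m 0)).
  by rewrite words_value iota_uniq.
have idx w : w \in words m 0 -> decomp_value H w = index w (words m 0).
  move=> ww.
  have := nth_index [::] ww => /(congr1 (decomp_value H)).
  rewrite -(nth_map [::] 0) ?index_mem // words_value nth_iota ?add0n //.
  by rewrite index_mem.
have := ab; rewrite (idx _ aw) (idx _ bw) => /(congr1 (nth [::] (words m 0))).
by rewrite !nth_index.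
Qed.

Lemma words_value_lt m a : a \in words m 0 -> decomp_value H a < H m.+1.
Proof.
move=> /(map_f (decomp_value H)).
by rewrite words_value mem_iota size_words_H.
Qed.

Lemma H_monotone m n : m <= n -> H m.+1 <= H n.+1.
Proof.
elim: n => [|n IH]; first by rewrite leqn0 => /eqP->.
rewrite leq_eqVlt => /predU1P[->//|/IH/leq_trans]; apply.
rewrite -!size_words_H size_wordsS // -{1}[size _]mul1n.
by apply: leq_trans (leq_addr _ _); rewrite leq_mul2r c1_gt0 orbT.
Qed.

Lemma legal_value a : legal L c a ->
  H (size a) <= decomp_value H a < H (size a).+1.
Proof.
case=> sa ta adm; have aw := admissible_words L0 adm.
rewrite words_value_lt // andbT.
case: a sa ta {adm aw} => [//|d b] _ d0.
rewrite decomp_value_cons (leq_trans _ (leq_addr _ _)) //.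
by rewrite -{1}[H _]mul1n leq_mul2r [0 < d]d0 orbT.
Qed.

(** The length is determined by the value, since [H] is nondecreasing and the intervals of
    [legal_value] are disjoint; at equal length [words_value_inj] applies. *)
Lemma legal_value_inj a b : legal L c a -> legal L c b ->
  decomp_value H a = decomp_value H b -> a = b.
Proof.
move=> la lb ab.
have [[sa _ adma] [sb _ admb]] := (la, lb).
have /andP[a1 a2] := legal_value la; have /andP[b1 b2] := legal_value lb.
have sab : size a = size b.
  apply/eqP; rewrite eqn_leq; apply/andP; split; rewrite leqNgt; apply/negP => lt.
  - case: (size a) sa lt a1 => [//|k] _; rewrite ltnS => lt a1.
    by have := H_monotone lt; lia.
  - case: (size b) sb lt b1 => [//|k] _; rewrite ltnS => lt b1.
    by have := H_monotone lt; lia.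
have aw := admissible_words L0 adma; have := admissible_words L0 admb.
by rewrite -sab => bw; exact: (words_value_inj aw bw).
Qed.

(** Leading zeros change neither the value nor the digit sum, so they are stripped until the word is
    legal or empty. *)
Lemma num_summands_word m a : a \in words m 0 ->
  num_summands L c H (decomp_value H a) = sumn a.
Proof.
elim: m a => [|m IH] a aw.
  have /size0nil-> := size_words aw.
  (* No legal string has value 0, so [xget] returns its default [[::]], whose sum is 0 as
     required. *)
  rewrite /num_summands /legal_decomp; case: xgetP => // b _ [/= lb].
  rewrite /decomp_value [in RHS]big_geq // => b0.
  have /andP[+ _] := legal_value lb; rewrite /decomp_value b0.
  by case: (hH) => /(_ (size b)) Hpos _; case: lb => /Hpos; case: (H _).
case: a aw => [/size_words//|[|d] b] aw.
  rewrite decomp_value_cons mul0n add0n IH //.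
  move: aw; rewrite mem_words_cons => /andP[_ /orP[/andP[]//|/andP[/eqP c0]]].
  by move: c1_gt0; rewrite -c0.
rewrite /num_summands /legal_decomp.
have la : legal L c (d.+1 :: b) by split=> //; exact: (words_admissible aw).
case: xgetP => [a' _ [/= la' eqa]|/(_ (d.+1 :: b)) []]; last by split.
by rewrite (legal_value_inj la' la).
Qed.

Lemma num_summands_iota m :
  map (num_summands L c H) (iota 0 (H m.+1)) = map sumn (words m 0).
Proof.
rewrite -size_words_H -words_value -map_comp.
by apply/eq_in_map => a /num_summands_word.
Qed.

(* The words of length [m.+1] whose leading digit is nonzero. *)
Definition long_words (m : nat) : seq (seq nat) :=
  [seq a :: b | a <- iota 1 (c 1).-1, b <- words m 0] ++
  [seq c 1 :: b | b <- words m 1].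

Lemma words_long m :
  words m.+1 0 = [seq 0 :: b | b <- words m 0] ++ long_words m.
Proof.
by rewrite wordsS // catA -(prednK c1_gt0).
Qed.

(** The words of length [m.+1] with leading digit 0 account exactly for the values below [H m.+1];
    cancelling them leaves the interval of interest. *)
Lemma num_summands_long m :
  map (num_summands L c H) (iota (H m.+1) (H m.+2 - H m.+1)) =
  map sumn (long_words m).
Proof.
have := num_summands_iota m.+1; rewrite words_long map_cat -map_comp.
rewrite -{1}(subnKC (H_monotone (leqnSn m))) iotaD map_cat num_summands_iota add0n.
by move/eqP; rewrite eqseq_cat ?size_map // => /andP[_ /eqP].
Qed.

End Values.

(** * Spread of the digit sums *)

Section Excess.
Set Implicit Arguments.
Unset Strict Implicit.
Variables (R : realType) (L : nat) (c H : nat -> nat) (hH : is_PLRS L c H).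
Hypothesis hdeg : (L, c 1) <> (1, 1).

Let L0 : 0 < L. Proof. by case: hH => _ [[]]. Qed.
Let c1_gt0 : 0 < c 1. Proof. by case: hH => _ [[]]. Qed.

Local Notation words := (words L c).
Local Notation long_words := (long_words L c).

(** This locates the least [q] with [c 1 + ... + c q >= 2]: it is 1 in the first case and [d.+2] in
    the second, where nondegeneracy forces [1 < L] and [c L] bounds the search. *)
Lemma second_digit : 1 < c 1 \/
  c 1 = 1 /\ exists d, [/\ d.+2 <= L, 0 < c d.+2 &
                          forall i, 1 < i < d.+2 -> c i = 0].
Proof.
case: (ltnP 1 (c 1)) => [|c1]; [by left|right].
have c11 : c 1 = 1 by lia.
have cL : 0 < c L by case: hH => _ [[]].
have L1 : 1 < L.
  by rewrite ltnNge; apply/negP => L1; apply: hdeg; rewrite c11; congr pair; lia.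
have exP : exists i, (1 < i) && (0 < c i) by exists L; rewrite L1.
split => //; case: (ex_minnP exP) => [[|[|d]] // /andP[_ cd] min].
exists d; split => //; first by apply: min; rewrite L1.
move=> i /andP[i1 id]; case: (posnP (c i)) => // ci.
by have := min i; rewrite i1 ci => /(_ isT); lia.
Qed.

(** After a leading 1 the first [d] zeros match vanishing coefficients; the last one is below
    [c d.+2], so it closes the block and frees the rest. *)
Lemma zeros_words d k b : c 1 = 1 -> d.+2 <= L -> 0 < c d.+2 ->
  (forall i, 1 < i < d.+2 -> c i = 0) ->
  b \in words k 0 -> nseq d.+1 0 ++ b \in words (d.+1 + k) 1.
Proof.
move=> c11 dL cd c0 bw.
suff h e j : e + j = d -> nseq e.+1 0 ++ b \in words (e.+1 + k) j.+1.
  by apply: h; rewrite addn0.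
elim: e j => [|e IH] j ej; rewrite addSn [nseq _ _]/= cat_cons mem_words_cons.
  by rewrite add0n in ej; rewrite ej cd bw dL.
by rewrite c0 ?eqxx /=; [rewrite IH ?addnS -?addSn //; lia|lia].
Qed.

Lemma one_word k : 0 < k -> exists2 b, b \in words k 0 & sumn b = 1.
Proof.
case: k => // k _; elim: k => [|k [b bw sb]].
  exists [:: 1] => //; rewrite mem_words_cons L0 !nil_words.
  case: second_digit => [->|[-> [d [dL _ _]]]]; first by rewrite L0.
  by rewrite eqxx; lia.
by exists (0 :: b) => //; rewrite mem_words_cons L0 c1_gt0 bw.
Qed.

Lemma long_words12 m : L <= m ->
  1 \in map sumn (long_words m) /\ 2 \in map sumn (long_words m).
Proof.
move=> Lm.
suff h (v : nat) : v = 0 \/ v = 1 -> v.+1 \in map sumn (long_words m).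
  by split; apply: h; auto.
move=> v01.
have word k' : 0 < k' -> exists2 b, b \in words k' 0 & sumn b = v.
  case: v01 => -> k0; last exact: one_word.
  by exists (nseq k' 0); rewrite ?nseq0_words // sumn_nseq.
case: second_digit => [c1|[c11 [d [dL cd c0]]]].
  have [|b bw sb] := word m; first lia.
  apply/mapP; exists (1 :: b); last by rewrite /= sb.
  rewrite mem_cat; apply/orP; left; apply/allpairsP; exists (1, b) => /=.
  by rewrite bw mem_iota; split=> //; lia.
have [|b bw sb] := word (m - d.+1); first lia.
apply/mapP; exists (1 :: nseq d.+1 0 ++ b); last first.
  by rewrite /= sumn_cat sumn_nseq mul0n sb.
rewrite mem_cat; apply/orP; right; apply/mapP; exists (nseq d.+1 0 ++ b).
  have -> : m = d.+1 + (m - d.+1) by lia.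
  exact: zeros_words.
by rewrite c11.
Qed.

Let B := (\sum_(1 <= i < L.+1) c i).+1.

(** The induction runs over all states [j], with the coefficients still ahead in place of the full
    sum. *)
Lemma size_words_ratio m : size (words m.+1 0) <= B * size (words m 0).
Proof.
suff h j : j < L -> size (words m.+1 j) <=
    (\sum_(j.+1 <= i < L.+1) c i).+1 * size (words m 0) by apply: h.
have mono k : size (words k 0) <= size (words k.+1 0).
  by rewrite !(size_words_H hH); apply: (H_monotone hH).
elim: m j => [|m IH] j jL; rewrite size_wordsS // big_ltn //.
  rewrite words0 //; case: (ltnP j.+1 L) => h; last by rewrite words_geL //=; lia.
  by rewrite words0 //=; lia.
have := mono m; case: (ltnP j.+1 L) => h; last first.
  by rewrite (words_geL _ _ h) /=; nia.
have := IH _ h; nia.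
Qed.

Lemma size_words_ratioX m q : size (words (q + m) 0) <= B ^ q * size (words m 0).
Proof.
elim: q => [|q IH]; first by rewrite mul1n.
apply: leq_trans (size_words_ratio _) _.
by rewrite expnS -mulnA leq_mul2l IH orbT.
Qed.

Local Open Scope ring_scope.

(* [0 <= excess s x t] for all [t] says that the digit sum has variance at
   least [x] on [s]; unlike the variance itself, [excess] is additive in [s]. *)
Definition excess (s : seq (seq nat)) (x t : R) : R :=
  \sum_(a <- s) (((sumn a)%:R - t) ^+ 2 - x).

Lemma excessE s x t :
  excess s x t = \sum_(a <- s) ((sumn a)%:R - t) ^+ 2 - x * (size s)%:R.
Proof.
rewrite /excess sumrB; congr (_ - _).
by rewrite big_const_seq count_predT iter_addr_0 mulr_natr.
Qed.

Lemma excess_cat s1 s2 x t : excess (s1 ++ s2) x t = excess s1 x t + excess s2 x t.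
Proof. exact: big_cat. Qed.

Lemma excess_cons d s x t :
  excess [seq d :: b | b <- s] x t = excess s x (t - d%:R).
Proof.
rewrite /excess big_map; apply: eq_bigr => b _ /=.
by rewrite natrD; congr (_ ^+ 2 - _); ring.
Qed.

Lemma excess_allpairs r s x t :
  excess [seq a :: b | a <- r, b <- s] x t = \sum_(a <- r) excess s x (t - a%:R).
Proof.
rewrite {1}/excess big_allpairs_dep; apply: eq_bigr => a _.
by rewrite -excess_cons /excess big_map.
Qed.

Lemma excess_antimono s x y t : x <= y -> excess s y t <= excess s x t.
Proof. by move=> xy; apply: ler_sum => a _; rewrite lerD2l lerN2. Qed.

Lemma excess_shift s x t :
  excess s x t + excess s x (t - 1) =
  2 * excess s x (t - 2^-1) + (size s)%:R / 2.
Proof.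
have -> : (size s)%:R / 2 = \sum_(a <- s) (2^-1 : R).
  by rewrite big_const_seq count_predT iter_addr_0 mulr_natl.
rewrite /excess mulr_sumr -!big_split /=.
by apply: eq_bigr => a _; field.
Qed.

(** * Passing variance bounds from shorter words to longer ones *)

Section Blocks.
Variables (p M : nat) (x : R).
Hypothesis ex_ge0 : forall k t, (p <= k < M)%N -> 0 <= excess (words k 0) x t.

(** The current block closes within [L - j] digits, so the words split into shifted copies of
    [words k 0] with [p <= k < M]. *)
Lemma excess_state m j t : (p + L <= m + j)%N -> (m <= M)%N ->
  0 <= excess (words m j) x t.
Proof.
elim: m j t => [|m IH] j t mj mM; case: (ltnP j L) => [jL|Lj];
  rewrite ?(words_geL _ _ Lj) ?/excess ?big_nil //; first lia.
rewrite -/(excess _ _ _) wordsS // excess_cat excess_allpairs excess_cons.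
apply: addr_ge0; last by apply: IH; lia.
by apply: sumr_ge0 => a _; apply: ex_ge0; lia.
Qed.

Lemma excess_zero m j t : (j < L)%N -> (0 < c j.+1)%N -> (p + L <= m < M)%N ->
  excess (words m 0) x t <= excess (words m.+1 j) x t.
Proof.
move=> jL cj mM; rewrite wordsS // excess_cat excess_allpairs excess_cons.
rewrite -(prednK cj) /= big_cons subr0 -addrA lerDl.
apply: addr_ge0; last by apply: excess_state; lia.
by apply: sumr_ge0 => a _; apply: ex_ge0; lia.
Qed.

Lemma excess_zeros m i t : (p + L <= m)%N -> (i + m <= M)%N ->
  excess (words m 0) x t <= excess (words (i + m) 0) x t.
Proof.
move=> pm; elim: i => [//|i IH] im.
apply: le_trans (IH _) (excess_zero _ _ _ _) => //; lia.
Qed.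

Lemma excess_one_zeros d m t : (d.+2 <= L)%N -> (0 < c d.+2)%N ->
  (forall i, 1 < i < d.+2 -> c i = 0)%N -> (p + L <= m)%N -> (d.+1 + m <= M)%N ->
  excess (words m 0) x t <= excess (words (d.+1 + m) 1) x t.
Proof.
move=> dL cd c0 pm mM.
suff h e j u : (e + j = d)%N ->
    excess (words m 0) x u <= excess (words (e.+1 + m) j.+1) x u.
  by apply: h; rewrite addn0.
elim: e j u => [|e IH] j u ej.
  by rewrite add0n in ej; apply: excess_zero; rewrite ?ej //; lia.
rewrite addSn wordsS ?excess_cat ?excess_cons ?excess_allpairs; last lia.
rewrite c0 /=; last lia.
by rewrite big_nil add0r subr0; apply: IH; lia.
Qed.

(* The lower bound comes from the words starting with [0^q] or [1 0^(q-1)],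
   where [q] is least with [c 1 + ... + c q >= 2]. *)
Lemma excess_gain : (p + 2 * L <= M)%N -> exists2 q, (0 < q <= L)%N &
  forall t, excess (words (M - q) 0) x t + excess (words (M - q) 0) x (t - 1)
            <= excess (words M 0) x t.
Proof.
move=> pM; case: second_digit => [c1|[c11 [d [dL cd c0]]]].
  exists 1%N => // t; have {3}-> : M = (M - 1).+1 by lia.
  rewrite wordsS // excess_cat excess_allpairs excess_cons.
  have -> : c 1 = (c 1 - 2).+2 by lia.
  rewrite /= !big_cons subr0 addrA.
  apply: ler_wpDr; first by apply: excess_state; lia.
  apply: ler_wpDr => //.
  by apply: sumr_ge0 => a _; apply: ex_ge0; lia.
(* The leading 0 is followed by further zeros, each closing a block; the leading 1 equals [c 1] and
   leads to state 1, which the next [d.+1] zeros leave for state 0. *)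
exists d.+2 => // t.
have {3}-> : M = (M - 1).+1 by lia.
rewrite wordsS // excess_cat excess_allpairs excess_cons c11 /= big_seq1 subr0.
have -> : (M - 1 = d.+1 + (M - d.+2))%N by lia.
apply: lerD; first by apply: excess_zeros; lia.
by apply: excess_one_zeros => //; lia.
Qed.

End Blocks.

(** Chosen so that [4 * L * e * size (words m 0) <= size (words (m - q) 0)] for [q <= L]: the gain,
    half the right side, then pays for raising the variance bound by [2 * L * e]. *)
Let e : R := (4 * L%:R * B%:R ^+ L)^-1.

Let e_gt0 : 0 < e.
Proof. by rewrite invr_gt0 !mulr_gt0 ?exprn_gt0 ?ltr0n. Qed.

Lemma excess_words_ge0 m t : 0 <= excess (words m 0) (e * (m%:R - 2 * L%:R)) t.
Proof.
elim/ltn_ind: m t => m IH t.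
case: (leqP m (2 * L)) => [mL|Lm].
  (* Here the claimed variance bound is nonpositive. *)
  apply: sumr_ge0 => a _; rewrite subr_ge0 (le_trans _ (sqr_ge0 _)) //.
  by rewrite pmulr_rle0 // subr_le0 -natrM ler_nat.
(* All lengths from [p] to [m - 1] satisfy the bound [x] by induction; the target for [m] exceeds
   [x] by [2 * L * e]. *)
pose p := (m - 2 * L)%N; pose x := e * (p%:R - 2 * L%:R).
have pE : p%:R = m%:R - 2 * L%:R :> R by rewrite natrB ?natrM // ltnW.
have [||q qL gain] := @excess_gain p m x; last 1 first.
- have {gain} := gain t; rewrite excess_shift => gain.
  have pos : 0 <= excess (words (m - q) 0) x (t - 2^-1).
    apply: le_trans (IH _ _ _) (excess_antimono _ _ _); first lia.
    by rewrite /x ler_pM2l // lerD2r ler_nat /p; lia.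
  have szq : (size (words m 0))%:R <= B%:R ^+ L * (size (words (m - q) 0))%:R :> R.
    rewrite -natrX -natrM ler_nat.
    have {1}-> : m = (q + (m - q))%N by lia.
    apply: leq_trans (size_words_ratioX _ _) _.
    by rewrite leq_mul2r leq_pexp2l ?orbT //; lia.
  have eB : 4 * L%:R * (e * B%:R ^+ L) = 1.
    by rewrite /e; field; rewrite ?pnatr_eq0 ?expf_neq0 ?pnatr_eq0 -?lt0n.
  have L0' : 0 < L%:R :> R by rewrite ltr0n.
  move: gain; rewrite !excessE in pos * => gain.
  rewrite /x pE in gain pos.
  have := ler_wpM2l (ltW e_gt0) szq.
  set A := (\sum_(a <- words m 0) _) in gain *.
  set n := (size (words m 0))%:R in gain *.
  set n' := (size (words (m - q) 0))%:R in gain pos *.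
  rewrite mulrA => h.
  have h2 : 4 * L%:R * (e * n) <= n'.
    rewrite [leRHS](_ : _ = 4 * L%:R * (e * B%:R ^+ L * n')).
      by rewrite ler_pM2l // mulr_gt0.
    by rewrite mulrA eB mul1r.
  nra.
- move=> k u /andP[pk km]; apply: le_trans (IH _ km u) (excess_antimono _ _ _).
  by rewrite /x ler_pM2l // lerD2r ler_nat.
- by rewrite /p; lia.
Qed.

(** A nonzero leading digit leaves copies of [words k 0] with [k >= m - L]; this loss of [L] digits
    turns [2 * L] into [3 * L]. *)
Lemma excess_long_ge0 m t : (L <= m)%N ->
  0 <= excess (long_words m) (e * (m%:R - 3 * L%:R)) t.
Proof.
move=> Lm; rewrite excess_cat excess_allpairs excess_cons.
pose p := (m - L)%N.
have ex k u : (p <= k)%N -> 0 <= excess (words k 0) (e * (m%:R - 3 * L%:R)) u.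
  move=> pk; apply: le_trans (excess_words_ge0 k u) (excess_antimono _ _ _).
  rewrite ler_pM2l //.
  have : m%:R <= k%:R + L%:R :> R by rewrite -natrD ler_nat /p in pk *; lia.
  lra.
apply: addr_ge0; first by apply: sumr_ge0 => a _; apply: ex; rewrite /p; lia.
apply: (@excess_state p m.+1) => //; last by rewrite /p; lia.
by move=> k u /andP[pk _]; exact: ex.
Qed.

Lemma sum_sqr_long_ge m (t : R) : (L <= m)%N ->
  2^-1 <= \sum_(a <- long_words m) ((sumn a)%:R - t) ^+ 2.
Proof.
move=> /long_words12[in1 in2].
rewrite -(big_map sumn xpredT (fun y => (y%:R - t) ^+ 2 : R)).
rewrite (perm_big _ (perm_to_rem in1)) big_cons.
have in2' : 2 \in rem 1%N (map sumn (long_words m)).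
  by rewrite (perm_mem (perm_to_rem in1)) inE in in2.
rewrite (perm_big _ (perm_to_rem in2')) big_cons /= addrA.
apply: ler_wpDr; first by apply: sumr_ge0 => a _; exact: sqr_ge0.
(* [(1 - t)^2 + (2 - t)^2 = 1/2 + (2 * t - 3)^2 / 2]. *)
by have := sqr_ge0 (2 * t - 3); nra.
Qed.

Lemma sum_sqr_long_linear : exists2 C : R, 0 < C & forall m (t : R), (L <= m)%N ->
  C * m.+1%:R * (size (long_words m))%:R <=
  \sum_(a <- long_words m) ((sumn a)%:R - t) ^+ 2.
Proof.
(* From [m.+1 >= K] on, [m - 3 * L] is at least [m.+1 / 2], whence [C1]. Below [K], [C2] brings the
   left side under the constant 1/2 of [sum_sqr_long_ge]. *)
pose K := (6 * L).+2.
pose C1 := e / 2; pose C2 : R := (2 * K%:R * (H K.+1)%:R)^-1.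
have HK : (0 < H K.+1)%N by case: hH => + _; apply.
have C1_gt0 : 0 < C1 by rewrite divr_gt0.
have C2_gt0 : 0 < C2 by rewrite invr_gt0 !mulr_gt0 ?ltr0n.
exists (Num.min C1 C2) => [|m t Lm]; first by rewrite lt_min C1_gt0.
have nneg : 0 <= m.+1%:R * (size (long_words m))%:R :> R by rewrite -natrM.
rewrite -mulrA; case: (leqP K m.+1) => mK.
  have := excess_long_ge0 t Lm; rewrite excessE subr_ge0; apply: le_trans.
  apply: le_trans (ler_wpM2r nneg (_ : _ <= C1)) _; first by rewrite ge_min lexx.
  rewrite mulrA; apply: ler_wpM2r => //; rewrite /C1 -mulrA ler_pM2l //.
  have : 6 * L%:R + 2 <= m.+1%:R :> R.
    by rewrite -natrM -natrD ler_nat addn2.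
  by rewrite -[m.+1]addn1 natrD; lra.
apply: le_trans (sum_sqr_long_ge t Lm).
apply: le_trans (ler_wpM2r nneg (_ : _ <= C2)) _; first by rewrite ge_min lexx orbT.
have le1 : (m.+1 * size (long_words m) <= K * H K.+1)%N.
  apply: leq_mul; first exact: ltnW.
  apply: (@leq_trans (size (words m.+1 0))).
    by rewrite (words_long hH) size_cat leq_addl.
  by rewrite (size_words_H hH); apply: (H_monotone hH); exact: ltnW.
rewrite -(ler_nat R) !natrM in le1.
apply: le_trans (ler_wpM2l (ltW C2_gt0) le1) _.
have nzK : K%:R != 0 :> R by rewrite pnatr_eq0.
have nzH : (H K.+1)%:R != 0 :> R by rewrite pnatr_eq0 -lt0n.
by rewrite /C2 le_eqVlt; apply/orP; left; apply/eqP; field; rewrite nzK nzH.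
Qed.

End Excess.

(** * Variance under the uniform law as a finite sum *)

Section Uniform.
Set Implicit Arguments.
Unset Strict Implicit.
Variable R : realType.
Local Open Scope ring_scope.
Local Open Scope ereal_scope.

Lemma counting_interval (lo d : nat) (A : set nat) :
  counting (A `&` [set w : nat | lo <= w < lo + d]%N)%classic =
  \sum_(i < d) \d_(lo + i)%N A :> \bar R.
Proof.
elim: d => [|d IH].
  rewrite big_ord0 (_ : _ `&` _ = set0)%classic ?measure0 //.
  by apply/seteqP; split => w //= []; lia.
rewrite big_ord_recr -IH /=.
rewrite (_ : A `&` _ = (A `&` [set w : nat | lo <= w < lo + d]%N) `|`
                       (A `&` [set (lo + d)%N]))%classic; last first.
  apply/seteqP; split => w /=; last by move=> [[Aw wd]|[Aw wd]]; split=> //; lia.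
  move=> [Aw wd]; case: (ltnP w (lo + d)) => wd'; [left|right]; split => //; lia.
rewrite measureU //; last first.
  by apply/seteqP; split => w //= [[_ wd] [_ we]]; lia.
congr (_ + _); rewrite diracE; case: (boolP (_ \in A)) => [/set_mem Ad|Ad].
  rewrite (_ : _ `&` _ = [set (lo + d)%N])%classic.
    by rewrite /= /counting asboolT // fset_set1 finmap.cardfs1.
  by apply/seteqP; split => [w []//|w /= ->].
rewrite (_ : _ `&` _ = set0)%classic ?measure0 //.
by apply/seteqP; split => w //= [Aw wd]; move: Ad; rewrite -wd mem_set.
Qed.

Lemma natr_inv_ge0 (d : nat) : (0 <= d%:R^-1 :> R)%R.
Proof. by rewrite invr_ge0. Qed.

(** Written as a scaled finite sum of Dirac masses, the law turns integrals into finite sums. *)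
Lemma uniform_natE (lo d : nat) : (0 < d)%N ->
  uniform_nat R lo (lo + d) =
  mscale (NngNum (natr_inv_ge0 d) : {nonneg R})
    (msum (fun i => \d_(lo + i)%N) d) :> (set nat -> \bar R).
Proof.
move=> d0; apply/funext => A.
rewrite /= /mnormalize /= /mscale /msum /mrestr /= !counting_interval.
rewrite (eq_bigr (fun=> 1%E)); last by move=> i _; rewrite diracT.
have -> : \sum_(i < d) 1 = (d%:R : R)%:E.
  by rewrite (eq_bigr (fun=> (1%R : R)%:E)) // sumEFin sumr_const card_ord.
by rewrite orbF eqe pnatr_eq0 -[d == _]negbK -lt0n d0 /= counting_interval muleC.
Qed.

Lemma integral_uniform (lo d : nat) (f : nat -> R) : (0 < d)%N ->
  (forall w, 0 <= f w)%R ->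
  \int[uniform_nat R lo (lo + d)]_w (f w)%:E =
  ((\sum_(w <- iota lo d) f w)%R / d%:R)%:E.
Proof.
move=> d0 f0; rewrite uniform_natE //.
rewrite ge0_integral_mscale //=; last by move=> w _; rewrite lee_fin.
rewrite ge0_integral_measure_sum //; last by move=> w _; rewrite lee_fin.
rewrite (eq_bigr (fun n : 'I_d => (f (lo + n)%N)%:E)); last first.
  move=> n _; rewrite (@integral_dirac _ _ (lo + n)%N R setT measurableT) //.
  by rewrite diracT mul1e.
rewrite sumEFin -EFinM mulrC. congr (_ * _)%:E.
rewrite -[X in iota X]addn0 iotaDl big_map.
by rewrite -[in RHS](subn0 d) -/(index_iota 0 d) big_mkord.
Qed.

(** The center [t] is the mean; it can stay abstract because the lower bounds above are uniform in
    [t]. *)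
Lemma variance_uniform (lo d : nat) (X : nat -> R) : (0 < d)%N ->
  exists t : R, 'V_(uniform_nat R lo (lo + d))[X] =
  ((\sum_(w <- iota lo d) (X w - t) ^+ 2)%R / d%:R)%:E.
Proof.
move=> d0; exists (fine 'E_(uniform_nat R lo (lo + d))[X]).
rewrite /variance covariance.unlock.
set t := fine _; rewrite expectation.unlock.
by rewrite -integral_uniform // => w; exact: sqr_ge0.
Qed.
End Uniform.

Local Open Scope ring_scope.

Theorem theorem1p7 (R : realType) (L : nat) (c H : nat -> nat)
    (hH : is_PLRS L c H) (hdeg : (L, c 1%N) <> (1%N, 1%N)) :
  exists C : R, 0 < C /\
    forall n : nat, (L < n)%N ->
      ((C * n%:R)%:E <=
        'V_(uniform_nat R (H n) (H n.+1))
          [fun w : nat => (num_summands L c H w)%:R : R])%E.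
Proof.
have [C C0 hC] := sum_sqr_long_linear R hH hdeg.
exists C; split => // -[//|m] Lm.
have Hle : (H m.+1 <= H m.+2)%N by apply: (H_monotone hH).
have sz : size (long_words L c m) = (H m.+2 - H m.+1)%N.
  by have := congr1 size (num_summands_long hH m); rewrite !size_map size_iota.
(* The interval is nonempty because some long word has digit sum 1. *)
have d0 : (0 < H m.+2 - H m.+1)%N.
  rewrite -sz; have [+ _] := long_words12 hH hdeg Lm.
  by case: (long_words L c m).
have [t] := variance_uniform (H m.+1) (fun w => (num_summands L c H w)%:R : R) d0.
rewrite subnKC // => ->.
rewrite lee_fin ler_pdivlMr ?ltr0n //.
rewrite -(big_map (num_summands L c H) xpredT (fun y => (y%:R - t) ^+ 2 : R)).
by rewrite (num_summands_long hH) big_map -sz; exact: hC.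
Qed.
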